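(* Let $\mathcal{I}(\sigma)=\{h\in\mathcal{H}(\omega^* ) : h \text{ is isomorphic to } \sigma\}$, considered as a subspace of $\mathcal{H}(\omega^* )$ with the compact-open topology, where $\sigma$ is the shift map. Then $\mathcal{I}(\sigma)$ is a Baire space: if $\{U_n : n\in\omega\}$ is a collection of dense open subsets of $\mathcal{I}(\sigma)$, then $\bigcap_{n<\omega}U_n$ is dense in $\mathcal{I}(\sigma)$.
   Context: $\omega^* = \beta\omega\setminus\omega$ is the space of non-principal ultrafilters on $\omega$; $\mathcal{H}(\omega^* )$ is the group of all self-homeomorphisms of $\omega^*$. The compact-open topology on $\mathcal{H}(\omega^* )$ is generated by the sets $\{h : h[K]\subseteq U\}$ with $K\subseteq\omega^*$ compact and $U\subseteq\omega^*$ open. The shift map $\sigma:\omega^*\to\omega^*$ sends an ultrafilter $u$ to the unique ultrafilter generated by $\{A+1 : A\in u\}$. Two maps $f,g\in\mathcal{H}(\omega^* )$ are isomorphic if there is $h\in\mathcal{H}(\omega^* )$ with $h\circ f=g\circ h$. *)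

(* Defs.v *)
From HB Require Import structures.
From mathcomp Require Import all_boot.
From mathcomp Require Import all_classical.
From mathcomp Require Import topology.

Set Implicit Arguments.
Unset Strict Implicit.
Unset Printing Implicit Defensive.

Local Open Scope classical_set_scope.

Record beta_omega := BetaOmega {
  beta_val :> set_system nat;
  beta_ultra : UltraFilter beta_val
}.

HB.instance Definition _ := gen_eqMixin beta_omega.
HB.instance Definition _ := gen_choiceMixin beta_omega.

(* The sets of ultrafilters containing A, for A a set of naturals, form a base
   of the topology of beta_omega. *)
Definition stone_base (A : set nat) : set beta_omega := [set u | beta_val u A].

Lemma stone_base_cover : \bigcup_(A in setT) stone_base A = setT.
Proof.
apply/seteqP; split=> // u _; exists setT => //.
by case: u => u uu; exact: (@filterT _ u).
Qed.

Lemma stone_base_join (A B : set nat) (u : beta_omega) :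
  setT A -> setT B -> stone_base A u -> stone_base B u ->
  exists C, [/\ setT C, stone_base C u &
                stone_base C `<=` stone_base A `&` stone_base B].
Proof.
move=> _ _; case: u => u uu uA uB; exists (A `&` B); split=> //.
  exact: (@filterI _ u).
by case=> v vv vAB; split; apply: (@filterS _ v _ _ _ _ vAB) => n [].
Qed.

HB.instance Definition _ :=
  isBaseTopological.Build beta_omega stone_base_cover stone_base_join.

Definition beta_principal (n : nat) : beta_omega :=
  BetaOmega (principal_filter_ultra n).

(* Used as a type, a set A : set T is the subtype {x : T | x \in A}, which the
   library equips with the subspace topology whenever T is a topologicalType;
   omega_star, homeo_group and iso_class are used in this way. *)
Definition omega_star : set beta_omega := setT `\` range beta_principal.

Lemma beta_eq (u v : beta_omega) :
  (forall A, beta_val u A <-> beta_val v A) -> u = v.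
Proof.
case: u v => [u uu] [v vv] /= uv.
have {}uv : u = v by rewrite predeqE.
by case: v / uv vv => vv; congr BetaOmega; exact: Prop_irrelevance.
Qed.

Lemma omega_star_eq (u v : omega_star) :
  (forall A, beta_val (\val u) A <-> beta_val (\val v) A) -> u = v.
Proof. by move=> uv; apply: val_inj; exact: beta_eq. Qed.

Lemma beta_principal_eq (u : beta_omega) (n : nat) :
  beta_val u [set n] -> u = beta_principal n.
Proof.
case: u => u uu /= un; apply: beta_eq => A /=.
have [mem_n|] := pselect (A n).
  split=> _; first exact/principal_filterP.
  by apply: (@filterS _ u _ _ _ _ un) => _ ->.
move=> nAn; split=> [uA|/principal_filterP //].
have /filter_ex[k [/= Ak kn]] : u (A `&` [set n]) by exact: (@filterI _ u).
by case: nAn; rewrite -kn.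
Qed.

Lemma omega_star_nonprincipal (u : omega_star) (n : nat) :
  ~ beta_val (\val u) [set n].
Proof.
case: u => u uP /= /beta_principal_eq un; move: uP; rewrite inE => -[_].
by apply; exists n.
Qed.

Lemma in_omega_star (u : beta_omega) :
  (forall n, ~ beta_val u [set n]) -> u \in omega_star.
Proof.
move=> un; rewrite inE; split=> // -[n _ nu]; apply: (un n).
by rewrite -nu; exact/principal_filterP.
Qed.

Definition shift_filter (u : set_system nat) : set_system nat :=
  filter_from u (fun A => succn @` A).

Lemma shift_filterE (u : set_system nat) (A : set nat) :
  Filter u -> shift_filter u A <-> u (succn @^-1` A).
Proof.
move=> uF; split=> [[B uB BA]|uA].
  by apply: filterS uB => n Bn; apply: BA; exists n.
by exists (succn @^-1` A) => // _ [n An <-].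
Qed.

Lemma shift_filter_ultra (u : beta_omega) : UltraFilter (shift_filter u).
Proof.
case: u => u uu; rewrite /=; have uF : Filter u by exact: filter_filter.
have sF : ProperFilter (shift_filter u).
  apply: filter_from_proper => [|A /filter_ex[n An]]; last by exists n.+1, n.
  apply: filter_from_filter; first by exists setT; exact: filterT.
  move=> A B uA uB; exists (A `&` B); first exact: filterI.
  by move=> _ [n [An Bn] <-]; split; exists n.
split=> // G GF sG; apply/seteqP; split=> // A GA.
have [uA|uA] := in_ultra_setVsetC (succn @^-1` A) uu.
  exact/shift_filterE.
have /sG GnA : shift_filter u (~` A) by exact/shift_filterE.
by have /filter_ex[n []] : G (A `&` ~` A) by exact: filterI.
Qed.

Lemma shift_filter_omega_star (u : omega_star) :
  BetaOmega (shift_filter_ultra (\val u)) \in omega_star.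
Proof.
apply: in_omega_star => n /=; have ? := beta_ultra (\val u).
move=> /shift_filterE un; case: n un => [|n] un.
  by have /filter_ex[k] := un.
apply: (@omega_star_nonprincipal u n).
by apply: (@filterS _ _ _ _ _ _ un) => k [].
Qed.

Definition shift_fun (u : omega_star) : omega_star :=
  SigSub (shift_filter_omega_star u).

Definition homeomorphism (X Y : topologicalType) (h : X -> Y) :=
  continuous h /\
  exists g : Y -> X, [/\ continuous g, cancel h g & cancel g h].

Definition homeo_group : set {compact-open, omega_star -> omega_star} :=
  [set h | homeomorphism h].

Definition unshift_filter (u : set_system nat) : set_system nat :=
  [set A | u (succn @` A)].

Lemma omega_star_gt0 (u : omega_star) : beta_val (\val u) (succn @` setT).
Proof.
have uu := beta_ultra (\val u).
have [//|u0] := in_ultra_setVsetC (succn @` setT) uu.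
case: (@omega_star_nonprincipal u 0%N).
apply: (@filterS _ _ _ _ _ _ u0) => -[//|n] /= nn.
by case: nn; exists n.
Qed.

Lemma unshift_filter_ultra (u : omega_star) :
  UltraFilter (unshift_filter (\val u)).
Proof.
have uu := beta_ultra (\val u); have u0 := omega_star_gt0 u.
have sF : ProperFilter (unshift_filter (\val u)).
  apply: Build_ProperFilter_ex.
    move=> A uA; have : beta_val (\val u) (succn @` A) by exact: uA.
    by move=> /filter_ex[_ [n An _]]; exists n.
  split=> //.
    move=> A B uA uB; rewrite /unshift_filter /=.
    have uAB : beta_val (\val u) (succn @` A `&` succn @` B).
      exact: filterI.
    apply: (@filterS _ (\val u)) uAB.
    by move=> _ [[n An <-] [m Bm [mn]]]; exists n => //; split=> //; rewrite -mn.
  move=> A B AB; rewrite /unshift_filter /= => uA; apply: (@filterS _ (\val u)) uA.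
  exact: image_subset.
split=> // G GF sG; apply/seteqP; split=> // A GA.
have [uA|uA] := in_ultra_setVsetC (succn @` A) uu; first exact: uA.
have /sG GnA : unshift_filter (\val u) (~` A).
  rewrite /unshift_filter /=; have uAB : beta_val (\val u) (succn @` setT `&` ~` (succn @` A)).
    exact: filterI.
  apply: (@filterS _ (\val u)) uAB => _ [[n _ <-] nA]; exists n => // An.
  by apply: nA; exists n.
by have /filter_ex[n []] : G (A `&` ~` A) by exact: filterI.
Qed.

Lemma unshift_filter_omega_star (u : omega_star) :
  BetaOmega (unshift_filter_ultra u) \in omega_star.
Proof.
apply: in_omega_star => n /=; rewrite /unshift_filter /= image_set1.
exact: omega_star_nonprincipal.
Qed.

Definition unshift_fun (u : omega_star) : omega_star :=
  SigSub (unshift_filter_omega_star u).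

Lemma shift_funK : cancel shift_fun unshift_fun.
Proof.
move=> u; apply: omega_star_eq => A /=; rewrite /unshift_filter /=.
have ? := beta_ultra (\val u); rewrite shift_filterE.
suff -> : succn @^-1` (succn @` A) = A by [].
by apply/seteqP; split=> [n [m Am [<-]]|n An] //; exists n.
Qed.

Lemma unshift_funK : cancel unshift_fun shift_fun.
Proof.
move=> u; apply: omega_star_eq => A /=.
have uu := beta_ultra (\val u); have u0 := omega_star_gt0 u.
have := unshift_filter_ultra u => ?; rewrite shift_filterE /unshift_filter /=.
split=> uA; first by apply: (@filterS _ (\val u)) uA => _ [n An <-].
have uAB : beta_val (\val u) (succn @` setT `&` A) by exact: filterI.
by apply: (@filterS _ (\val u)) uAB => _ [[n _ <-] An]; exists n.
Qed.

Lemma omega_star_nbhs (u : omega_star) (A : set nat) :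
  beta_val (\val u) A -> nbhs u [set v : omega_star | beta_val (\val v) A].
Proof.
move=> uA; exists [set v : omega_star | beta_val (\val v) A]; split=> //.
exists (stone_base A) => //; exists [set A] => //.
by rewrite bigcup_set1.
Qed.

Lemma omega_star_nbhsP (u : omega_star) (V : set omega_star) :
  nbhs u V -> exists2 A, beta_val (\val u) A &
    [set v : omega_star | beta_val (\val v) A] `<=` V.
Proof.
move=> [_ [[_ [D _ <-] <-]] [A DA uA] DV]; exists A => // v vA.
by apply: DV; exists A.
Qed.

Lemma shift_fun_homeo : homeomorphism shift_fun.
Proof.
split; last exists unshift_fun; last split.
- move=> u V /omega_star_nbhsP[A uA AV]; have ? := beta_ultra (\val u).
  have /omega_star_nbhs : beta_val (\val u) (succn @^-1` A).
    by apply/shift_filterE; exact: uA.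
  apply: (@filterS _ (nbhs u)) => v vA; have ? := beta_ultra (\val v).
  by apply: AV => /=; apply/shift_filterE; exact: vA.
- move=> u V /omega_star_nbhsP[A uA AV].
  have /omega_star_nbhs : beta_val (\val u) (succn @` A) by exact: uA.
  by apply: (@filterS _ (nbhs u)) => v vA; exact: AV.
- exact: shift_funK.
- exact: unshift_funK.
Qed.

Definition shift : homeo_group := SigSub (mem_set shift_fun_homeo).

Definition isomorphic (f g : homeo_group) :=
  exists h : homeo_group, \val h \o \val f = \val g \o \val h.

Definition iso_class (f : homeo_group) : set homeo_group :=
  [set h | isomorphic h f].

Definition baire_space (X : topologicalType) :=
  forall U : nat -> set X, (forall n, open (U n) /\ dense (U n)) ->
    dense (\bigcap_n U n).

(* Main.v *)
(* A base of the compact-open topology on the homeomorphisms of omega^* is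
   given by finite lists L of constraints h[A^*] <= B^*. Such a list makes
   omega a directed graph, with a -> b when a \in A implies b \in B for
   every (A, B) in L. If some conjugate of the shift obeys L, then the set
   of points reachable from a by paths avoiding a given finite set is
   invariant under this conjugate, hence cofinite, because the shift has no
   clopen invariant set other than the empty set and omega^*. So, outside a
   finite set, any two points are joined by a path of fresh points. Given an
   increasing sequence L_k of such lists, joining points one after the other
   yields an enumeration f of omega that eventually follows the graph of
   every L_k; the conjugate of the shift by the permutation f then obeys all
   the L_k at once. Hence countable descending sequences of basic open sets
   meeting the isomorphism class have a common point in it. *)
Require Import Defs.
From mathcomp Require Import all_boot all_classical topology.

Set Implicit Arguments.
Unset Strict Implicit.
Unset Printing Implicit Defensive.

Local Open Scope classical_set_scope.

(** * Compactness and ultrafilter tools *)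

(** The sets [V] with [P (K \ V)] form a filter, which is proper if [P K] fails. It then clusters at
    some [x] in [K], but a neighbourhood [U] of [x] with [P U] puts the complement of [U] into the
    filter. *)
Lemma compact_ind (X : topologicalType) (K : set X) (P : set X -> Prop) :
  compact K -> P set0 -> (forall S T, S `<=` T -> P T -> P S) ->
  (forall S T, P S -> P T -> P (S `|` T)) ->
  (forall x, K x -> exists2 U, nbhs x U & P U) -> P K.
Proof.
move=> Kc P0 PS PU Ploc; apply: contrapT => nPK.
pose F : set_system X := [set V | P (K `\` V)].
have FF : ProperFilter F.
  apply: Build_ProperFilter; first by rewrite /F /= setD0.
  split; rewrite /F /=; first by rewrite setDT.
    by move=> V W PV PW; rewrite /= setDIr; exact: PU.
  by move=> V W VW; apply: PS; exact: setDS.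
have [|x [Kx xF]] := Kc F FF; first by rewrite /F /= setDv.
have [U xU PU'] := Ploc x Kx.
have [|y [/= nUy Uy]] := xF (~` U) U _ xU; last exact: nUy.
by rewrite /F /=; apply: PS PU' => y [_ /contrapT].
Qed.

Lemma ultrafilter_dichotomy (T : Type) (F : set_system T) : ProperFilter F ->
  (forall A, F A \/ F (~` A)) -> UltraFilter F.
Proof.
move=> FF dich; split=> // G GF FG; apply/seteqP; split=> // A GA.
have [//|/FG GnA] := dich A.
by have /filter_ex[n []] : G (A `&` ~` A) by exact: filterI.
Qed.

Lemma fmap_ultrafilter (T U : Type) (f : T -> U) (F : set_system T) :
  UltraFilter F -> UltraFilter (fmap f F).
Proof.
move=> FU; apply: ultrafilter_dichotomy => A.
exact: (in_ultra_setVsetC (f @^-1` A)).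
Qed.

Lemma filter_forall_in (T : Type) (I : eqType) (F : set_system T) (s : seq I)
    (P : I -> set T) : Filter F -> (forall i, i \in s -> F (P i)) ->
  F [set x | forall i, i \in s -> P i x].
Proof.
move=> FF; elim: s => [_|i s IHs sP]; first by apply: filterE => x i.
have Fi := sP i (mem_head _ _).
have Fs : F [set x | forall i, i \in s -> P i x].
  by apply: IHs => j js; apply: sP; rewrite inE js orbT.
apply: filterS2 Fi Fs => x Pi Ps j; rewrite inE => /predU1P[->//|]; exact: Ps.
Qed.

(** * Clopen subsets and compactness of omega^* *)

Definition star (A : set nat) : set omega_star := [set u | beta_val (\val u) A].

#[local] Instance omega_star_ultra (u : omega_star) :
  UltraFilter (beta_val (\val u)).
Proof. exact: beta_ultra. Qed.

Lemma starC (A : set nat) : star (~` A) = ~` star A.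
Proof.
apply/seteqP; split=> u uA.
  by move=> uA'; have [n []] := filter_ex (filterI uA uA').
by case: (in_ultra_setVsetC A (omega_star_ultra u)).
Qed.

Lemma star_open (A : set nat) : open (star A).
Proof. by rewrite openE => u uA; exact: omega_star_nbhs. Qed.

Lemma star_closed (A : set nat) : closed (star A).
Proof. by rewrite -(setCK A) starC closedC; exact: star_open. Qed.

Lemma star_infinite (u : omega_star) (A : set nat) :
  star A u -> infinite_set A.
Proof.
move=> uA /finite_seqP[s As]; move: uA; rewrite As => uA.
have uC : beta_val (\val u) [set n | forall i, i \in s -> n != i].
  apply: (filter_forall_in (P := fun i => [set n | n != i])) => i _.
  have [ui|] := in_ultra_setVsetC [set i] (omega_star_ultra u).
    by have := omega_star_nonprincipal ui.
  by apply: filterS => n /= /eqP.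
have [n [/= ns nC]] := filter_ex (filterI uA uC).
by have := nC n ns; rewrite eqxx.
Qed.

(** The filter of sets containing almost all of [A] extends to an ultrafilter, which is
    non-principal since the filter contains every cofinite set. *)
Lemma infinite_star (A : set nat) : infinite_set A -> star A !=set0.
Proof.
move=> Ainf.
pose F : set_system nat := [set B | finite_set (A `\` B)].
have FF : ProperFilter F.
  apply: Build_ProperFilter; first by rewrite /F /= setD0.
  split; rewrite /F /=; first by rewrite setDT.
    by move=> V W fV fW; rewrite /= setDIr finite_setU.
  by move=> V W VW; apply: sub_finite_set; exact: setDS.
have [G [GU FG]] := ultraFilterLemma FF.
have uG n : ~ G [set n].
  move=> Gn; have /FG GnC : F (~` [set n]).
    by apply: (@sub_finite_set _ _ [set n]) => // m [_ /contrapT].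
  by have /filter_ex[m []] : G ([set n] `&` ~` [set n]) by exact: filterI.
exists (SigSub (in_omega_star (u := BetaOmega GU) uG)) => /=.
by apply: FG; rewrite /F /= setDv.
Qed.

Lemma cofinite_mem_star (A : set nat) (u : omega_star) :
  finite_set (~` A) -> star A u.
Proof.
move=> fA; have [//|/star_infinite] := in_ultra_setVsetC A (omega_star_ultra u).
by move=> /(_ fA).
Qed.

Lemma omega_star_compact : compact (setT : set omega_star).
Proof.
rewrite compact_ultra => F FU _.
(* This ultrafilter on omega is the limit of [F]. *)
have uU : UltraFilter [set A | F (star A)].
  apply: ultrafilter_dichotomy => [|A]; last first.
    by rewrite /= starC; exact: in_ultra_setVsetC.
  apply: Build_ProperFilter_ex => [A /= FA|].
    by have [u uA] := filter_ex FA; exact: filter_ex uA.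
  split=> /=; first by apply: filterE => u; exact: filterT.
    by move=> A B /= FA FB; apply: filterS2 FA FB => u; exact: filterI.
  by move=> A B AB /=; apply: filterS => u; exact: filterS.
have uP n : ~ beta_val (BetaOmega uU) [set n].
  by move=> /= Fn; have [u] := filter_ex Fn; exact: omega_star_nonprincipal.
exists (SigSub (in_omega_star uP)); split=> // V /omega_star_nbhsP[A uA AV].
exact: (@filterS _ F _ (star A)).
Qed.

Lemma star_compact (A : set nat) : compact (star A).
Proof.
exact: (subclosed_compact (@star_closed A) omega_star_compact (@subsetT _ _)).
Qed.

Lemma starU (A B : set nat) : star (A `|` B) = star A `|` star B.
Proof.
apply/seteqP; split=> u; last by case; apply: filterS => n; [left|right].
move=> uAB; have [|uA] := in_ultra_setVsetC A (omega_star_ultra u).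
  by left.
by right; apply: filterS2 uAB uA => n [].
Qed.

Lemma star0 : star set0 = set0.
Proof. by apply/seteqP; split=> // u /star_infinite; apply. Qed.

(** Compact induction on [V], with a single clopen set [star A] squeezed between the part already
    covered and [V]. *)
Lemma clopen_star (V : set omega_star) : open V -> closed V ->
  exists A, V = star A.
Proof.
move=> Vo Vc; suff [A [VA AV]] : exists A, V `<=` star A /\ star A `<=` V.
  by exists A; apply/seteqP.
have cV : compact V := subclosed_compact Vc omega_star_compact (@subsetT _ V).
pose P S := exists A, S `<=` star A /\ star A `<=` V.
apply: (@compact_ind _ V P cV).
- by exists set0; rewrite star0; split.
- by move=> S T ST [A [TA AV]]; exists A; split=> //; exact: subset_trans TA.
- move=> S T [A [SA AV]] [B [TB BV]]; exists (A `|` B); rewrite starU; split.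
    exact: setUSS.
  by rewrite subUset.
- move=> u Vu; have uV : nbhs u V by exact: open_nbhs_nbhs.
  have [A uA AV] := omega_star_nbhsP uV.
  by exists (star A); [exact: omega_star_nbhs | exists A; split].
Qed.

(** This refines a compact-open constraint to one between clopen sets, which a pair of subsets of
    omega encodes; continuity supplies such a pair at each point of [K]. *)
Lemma compact_open_star (h : omega_star -> omega_star) (K U : set omega_star) :
  continuous h -> compact K -> open U -> h @` K `<=` U ->
  exists A B, [/\ K `<=` star A, h @` star A `<=` star B & star B `<=` U].
Proof.
move=> hc Kc Uo hKU.
pose P S := exists A B,
  [/\ S `<=` star A, h @` star A `<=` star B & star B `<=` U].
apply: (@compact_ind _ K P Kc).
- by exists set0, set0; rewrite star0 image_set0; split.
- move=> S T ST [A [B [TA AB BU]]]; exists A, B; split=> //.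
  exact: subset_trans TA.
- move=> S T [A [B [SA AB BU]]] [A' [B' [TA' AB' BU']]].
  exists (A `|` A'), (B `|` B'); rewrite !starU image_setU; split.
  + exact: setUSS.
  + exact: setUSS.
  + by rewrite subUset.
- move=> u Ku; have /omega_star_nbhsP[B uB BU] : nbhs (h u) U.
    by apply: open_nbhs_nbhs; split=> //; apply: hKU; exists u.
  have /hc/omega_star_nbhsP[A uA AB] := omega_star_nbhs uB.
  exists (star A); first exact: omega_star_nbhs.
  by exists A, B; split=> // _ [v vA <-]; exact: AB.
Qed.

(** * Enumerating omega along a decreasing sequence of digraphs *)

Section Enumeration.
Variables (E : nat -> rel nat) (F : nat -> set nat).
Hypothesis E_decr : forall k, subrel (E k.+1) (E k).
Hypothesis F0 : F 0%N = set0.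
Hypothesis F_finite : forall k, finite_set (F k).
Hypothesis walk : forall k a b (s : seq nat), ~ F k a -> ~ F k b ->
  a \in s -> b \notin s -> exists q, [/\ path (E k) a q, last a q = b,
    uniq q & all (fun x => x \notin s) q].

(** Induction on [w]: a missing entry is outside [F k], because [0 :: t] contains [F k], so a walk
    through fresh points reaches it. *)
Lemma walk_cover k (t w : seq nat) :
  uniq (0%N :: t) -> (forall x, F k x -> x \in 0%N :: t) ->
  ~ F k (last 0%N t) ->
  exists q, [/\ path (E k) (last 0%N t) q, uniq (0%N :: t ++ q),
    ~ F k (last 0%N (t ++ q)) & {subset w <= 0%N :: t ++ q}].
Proof.
move=> tU Ft Fl; elim: w => [|x w [q [qE qU Fq wq]]].
  by exists [::]; rewrite cats0; split.
have Ftq y : F k y -> y \in 0%N :: t ++ q.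
  by move=> /Ft; rewrite -cat_cons mem_cat => ->.
have [xq|xNq] := boolP (x \in 0%N :: t ++ q).
  by exists q; split=> // y; rewrite inE => /predU1P[->//|/wq].
have [|r [rE rl rU rN]] := walk Fq _ (mem_last _ _) xNq.
  by move=> /Ftq; rewrite (negPf xNq).
have qrl : last 0%N (t ++ (q ++ r)) = x by rewrite catA last_cat.
exists (q ++ r); split.
- by rewrite cat_path qE -last_cat.
- by rewrite catA -cat_cons cat_uniq qU rU -all_predC rN.
- by rewrite qrl => /Ftq; rewrite (negPf xNq).
- move=> y; rewrite inE catA -cat_cons mem_cat => /predU1P[->|/wq -> //].
  rewrite -mem_cat cat_cons -catA -qrl; exact: mem_last.
Qed.

(** Invariant of the finite enumeration: once all of [F k] is listed, fresh points are legitimate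
    targets of [walk], and the last entry is a legitimate start. *)
Definition stage k (t : seq nat) := [/\ uniq (0%N :: t),
  forall x, F k x -> x \in 0%N :: t & ~ F k (last 0%N t)].

Lemma stage_step k t : stage k t -> exists q, [/\ stage k.+1 (t ++ q),
  path (E k) (last 0%N t) q, k \in 0%N :: t ++ q & (0 < size q)%N].
Proof.
move=> [tU Ft Fl]; have /finite_seqP[w Fw] := F_finite k.+1.
have [q [qE qU Fq wq]] := walk_cover (k :: w) tU Ft Fl.
(* A point beyond everything listed. As [q] has covered [F k.+1], ending at [z] keeps the last entry
   outside [F k.+1]. *)
pose z := (\max_(x <- 0%N :: t ++ q) x).+1.
have zN : z \notin 0%N :: t ++ q.
  apply/negP => zq.
  have := leq_bigmax_seq (P := xpredT) (F := fun x => x) z zq isT.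
  by rewrite ltnn.
have Ftq y : F k y -> y \in 0%N :: t ++ q.
  by move=> /Ft; rewrite -cat_cons mem_cat => ->.
have [|r [rE rl rU rN]] := walk Fq _ (mem_last _ _) zN.
  by move=> /Ftq; rewrite (negPf zN).
have qrl : last 0%N (t ++ (q ++ r)) = z by rewrite catA last_cat.
have sub y : y \in 0%N :: t ++ q -> y \in 0%N :: t ++ (q ++ r).
  by rewrite catA -(cat_cons _ _ r) (mem_cat _ _ r) => ->.
have FSw x : F k.+1 x -> x \in w by rewrite Fw.
exists (q ++ r); split; first split.
- by rewrite catA -cat_cons cat_uniq qU rU -all_predC rN.
- by move=> x /FSw xw; apply/sub/wq; rewrite inE xw orbT.
- rewrite qrl => /FSw zw; have : z \in 0%N :: t ++ q.
    by apply: wq; rewrite inE zw orbT.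
  by rewrite (negPf zN).
- by rewrite cat_path qE -last_cat.
- by apply/sub/wq/mem_head.
(* An empty [r] would make the fresh point [z] the last entry of [0 :: t ++ q]. *)
- case: r {rE rN rU sub} rl qrl => [|x r] _; last by rewrite size_cat addnS.
  move=> qz; move: zN; rewrite -qz cats0; have := mem_last 0%N (t ++ q).
  by move=> ->.
Qed.

Lemma E_subrel k K : (k <= K)%N -> subrel (E K) (E k).
Proof.
elim: K => [|K IHK]; first by rewrite leqn0 => /eqP ->.
by rewrite leq_eqVlt => /predU1P[-> //|/IHK kK] a b /E_decr/kK.
Qed.

Lemma enumeration_exists : exists f g : nat -> nat, [/\ cancel f g, cancel g f &
  forall k, exists M, forall m, (M <= m)%N -> E k (f m) (f m.+1)].
Proof.
(* The premise [stage k t] sits under the existential so that [choice] yields a total function. *)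
have step k t : exists q, stage k t -> [/\ stage k.+1 (t ++ q),
  path (E k) (last 0%N t) q, k \in 0%N :: t ++ q & (0 < size q)%N].
  have [/stage_step[q qP]|nt] := pselect (stage k t); first by exists q.
  by exists [::].
have [N {}NP] := choice (fun kt => step kt.1 kt.2).
have {}NP k t := NP (k, t).
pose T := fix T k := if k is k'.+1 then T k' ++ N (k', T k') else [::].
have TP k : stage k (T k).
  elim: k => [|k /NP[]//]; split=> //; rewrite F0 //.
have Tsub k K : (k <= K)%N ->
    exists2 q, T K = T k ++ q & path (E k) (last 0%N (T k)) q.
  elim: K => [|K IHK]; first by rewrite leqn0 => /eqP ->; exists [::].
  rewrite leq_eqVlt => /predU1P[->|]; first by exists [::]; rewrite ?cats0.
  move=> kK; have [q Tq qE] := IHK kK; exists (q ++ N (K, T K)).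
    by rewrite /= {1}Tq catA.
  rewrite cat_path qE -last_cat -Tq; have [_ NE _ _] := NP K _ (TP K).
  exact: (sub_path (E_subrel (ltnSE kK)) NE).
have Tsize k : (k <= size (T k))%N.
  elim: k => // k IHk /=; have [_ _ _] := NP k _ (TP k).
  by move=> N0; rewrite size_cat -addn1; exact: leq_add.
(* The list [0 :: T m] has more than [m] entries by [Tsize], so the default value is never read. *)
pose f m := nth 0%N (0%N :: T m) m.
have fE k m : (m <= size (T k))%N -> f m = nth 0%N (0%N :: T k) m.
  move=> mk; have [km|mk'] := leqP k m.
    have [q Tq _] := Tsub _ _ km; rewrite /f Tq -cat_cons nth_cat /=.
    by rewrite ltnS mk.
  have [q Tq _] := Tsub _ _ (ltnW mk'); rewrite /f Tq -cat_cons nth_cat /=.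
  by rewrite ltnS Tsize.
have finj : injective f.
  move=> m n; have := leq_maxl m n; have := leq_maxr m n.
  move: (maxn m n) => k nk mk.
  rewrite (fE k) ?(leq_trans mk) // (fE k n) ?(leq_trans nk) //.
  have [kU _ _] := TP k.
  move=> /eqP; rewrite nth_uniq // ?ltnS ?(leq_trans mk) ?(leq_trans nk) //.
  by move/eqP.
have fsurj n : exists m, f m = n.
  have [_ _ nT _] := NP n _ (TP n); exists (index n (0%N :: T n.+1)).
  rewrite (fE n.+1); first exact: nth_index.
  by rewrite -ltnS; have := nT; rewrite -index_mem.
have [g fg] := choice fsurj.
exists f, g; split=> //; first by move=> m; exact: finj.
(* [size (T k)] is the index of the last entry of [0 :: T k], after which only steps of [E k] are
   appended. *)
move=> k; exists (size (T k)) => m km.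
have [|q Tq qE] := Tsub k (maxn k m.+1); first exact: leq_maxl.
have mT : (m < size (T (maxn k m.+1)))%N.
  by apply: leq_trans (Tsize _); exact: leq_maxr.
move: (mT); rewrite !(fE (maxn k m.+1)) ?(ltnW mT) // Tq size_cat => mTq.
move/(pathP 0%N): qE => /(_ (m - size (T k)))%N.
rewrite -(ltn_add2l (size (T k))) subnKC // => /(_ mTq).
(* Regrouped so that the path [q] is read together with its starting point, at offset
   [size (T k)]. *)
have -> : 0%N :: T k ++ q = belast 0%N (T k) ++ last 0%N (T k) :: q.
  by rewrite -cat_cons lastI cat_rcons.
by rewrite !nth_cat size_belast !ltnNge km (leqW km) subSn.
Qed.
End Enumeration.

(** * The digraph of a list of constraints *)

Definition edge (L : seq (set nat * set nat)) (a b : nat) :=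
  forall p, p \in L -> p.1 a -> p.2 b.

Definition obeys (L : seq (set nat * set nat)) (h : omega_star -> omega_star) :=
  forall p, p \in L -> h @` star p.1 `<=` star p.2.

Definition dead_ends (L : seq (set nat * set nat)) : set nat :=
  [set a | finite_set [set b | edge L a b]] `|`
  [set b | finite_set [set a | edge L a b]].

(** A pair whose first set is in [u] has its second set in [h u], so [B] can require it; any other
    pair is made vacuous by removing its first set from [A]. *)
Lemma edge_rectangle L h (u : omega_star) : obeys L h ->
  exists A B, [/\ star A u, star B (h u) &
    forall a b, A a -> B b -> edge L a b].
Proof.
move=> Lh.
exists [set a | forall p, p \in L -> ~ star p.1 u -> ~ p.1 a].
exists [set b | forall p, p \in L -> star p.1 u -> p.2 b]; split.
- apply: (filter_forall_in
    (P := fun p => [set a | ~ star p.1 u -> ~ p.1 a])) => p _.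
  have [up|up] := in_ultra_setVsetC p.1 (omega_star_ultra u).
    by apply: filterE => n /(_ up).
  by apply: filterS up => n nn _ /nn.
- apply: (filter_forall_in
    (P := fun p : set nat * set nat => [set b | star p.1 u -> p.2 b])) => p pL.
  have [up|up] := pselect (star p.1 u); last by apply: filterE => n /up.
  have hup : star p.2 (h u) by apply: (Lh _ pL); exists u.
  by apply: filterS hup => n pn _.
- move=> a b Aa Bb p pL pa; apply: Bb => //; apply: contrapT => up.
  exact: Aa pL up pa.
Qed.

(** A non-principal ultrafilter on infinitely many points of finite out-degree contradicts
    [edge_rectangle], since [B] is infinite. For in-degrees, write the ultrafilter as [h u] and use
    that [A] is infinite. *)
Lemma dead_ends_finite L (h : omega_star -> omega_star) : homeomorphism h ->
  obeys L h -> finite_set (dead_ends L).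
Proof.
move=> [_ [g [_ hg gh]]] Lh; rewrite finite_setU; split; apply: contrapT.
  move=> /infinite_star[u ubad].
  have [A [B [uA huB AB]]] := edge_rectangle u Lh.
  have [a [Aa /= afin]] := filter_ex (filterI uA ubad).
  by apply: (star_infinite huB); apply: sub_finite_set afin => b; exact: AB.
move=> /infinite_star[v]; rewrite -(gh v); move: (g v) => u ubad.
have [A [B [uA huB AB]]] := edge_rectangle u Lh.
have [b [Bb /= bfin]] := filter_ex (filterI huB ubad).
by apply: (star_infinite uA); apply: sub_finite_set bfin => a /AB; exact.
Qed.

(** * Invariant clopen sets and reachability *)

(** No non-principal ultrafilter contains the set [D] of exits from [C], so [D] is finite. Beyond it
    [C] is closed under successor: it contains a tail of omega or misses one. *)
Lemma shift_invariant (C : set nat) :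
  (forall u, star C u -> star C (shift_fun u)) ->
  finite_set C \/ finite_set (~` C).
Proof.
move=> Cinv; pose D := C `\` succn @^-1` C.
have [M DM] : exists M, forall m, (M <= m)%N -> C m -> C m.+1.
  have /finite_seqP[s Ds] : finite_set D.
    apply: contrapT => /infinite_star[u uD].
    have /Cinv/shift_filterE uC : star C u by apply: filterS uD => n [].
    by have [n [[_ nC] /nC]] := filter_ex (filterI uD uC).
  exists (\max_(x <- s) x).+1 => m sm Cm; apply: contrapT => nCm.
  have : D m by [].
  rewrite Ds /= => ms.
  have := leq_bigmax_seq (P := xpredT) (F := fun x => x) m ms isT.
  by rewrite leqNgt sm.
have [[m Mm Cm]|noC] := pselect (exists2 m, (M <= m)%N & C m).
  right; apply: sub_finite_set (finite_II m) => n nCn /=; rewrite ltnNge.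
  apply/negP => /subnKC mn; apply: nCn; rewrite -mn.
  elim: (n - m)%N => [|d IHd]; first by rewrite addn0.
  by rewrite addnS; apply: DM => //; rewrite (leq_trans Mm) ?leq_addr.
left; apply: sub_finite_set (finite_II M) => n Cn /=; rewrite ltnNge.
by apply/negP => Mn; apply: noC; exists n.
Qed.

Lemma homeo_groupP (h : homeo_group) : homeomorphism (\val h).
Proof. by case: h => h /= /set_mem. Qed.

(** The conjugating homeomorphism carries [star X] to a clopen set [star C] mapped into itself by
    the shift. *)
Lemma iso_shift_invariant (h : homeo_group) (X : set nat) :
  isomorphic h shift -> (forall u, star X u -> star X (\val h u)) ->
  star X !=set0 -> star X = setT.
Proof.
move=> [phi phih] Xinv [u0 Xu0].
have [phic [psi [psic psiK phiK]]] := homeo_groupP phi.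
have phihE u : \val phi (\val h u) = shift_fun (\val phi u).
  by have := congr1 (@^~ u) phih.
have [C CE] : exists C, psi @^-1` star X = star C.
  have Xo := @star_open X; have Xc := @star_closed X.
  have [] := @clopen_star (psi @^-1` star X).
  - exact: open_comp.
  - exact: closed_comp.
  - by move=> C CE; exists C.
have inC v : star C v = star X (psi v) by rewrite -CE.
have [u|fC|fC] := @shift_invariant C.
- rewrite !inC => /Xinv; congr (star X _).
  by rewrite -[LHS]psiK phihE phiK.
- by have := Xu0; rewrite -(psiK u0) -inC => /star_infinite.
- apply/seteqP; split=> // u _; rewrite -(psiK u) -inC.
  exact: cofinite_mem_star.
Qed.

Lemma edge_walk L (h : homeo_group) a b (s : seq nat) :
  isomorphic h shift -> obeys L (\val h) ->
  ~ dead_ends L a -> ~ dead_ends L b -> a \in s -> b \notin s ->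
  exists q, [/\ path (fun x y => `[< edge L x y >]) a q, last a q = b,
    uniq q & all (fun x => x \notin s) q].
Proof.
move=> hs Lh /not_orP[ainf _] /not_orP[_ binf] sa sb.
set e := fun x y : nat => `[< edge L x y >].
(* Points reached by a nonempty path that avoids [s] after its start; [a] itself lies in [s]. *)
pose X := [set c | exists p, path e a (rcons p c) /\
  all (fun x => x \notin s) (rcons p c)].
have sC u : star (~` [set` s]) u by apply: cofinite_mem_star; rewrite setCK.
have XT : star X = setT.
  apply: (iso_shift_invariant hs) => [u uX|].
    (* Some [c] in both [X] and [A] has an edge to all of [B], so [B] minus [s] lies in [X]. *)
    have [A [B [uA huB AB]]] := edge_rectangle u Lh.
    have [c [[p [pe ps]] Ac]] := filter_ex (filterI uX uA).
    apply: filterS (filterI huB (sC (\val h u))) => d [Bd /negP ds].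
    exists (rcons p c); rewrite all_rcons ds ps; split=> //.
    by rewrite rcons_path pe last_rcons; apply/asboolP; exact: AB.
  have [u ua] := infinite_star ainf; exists u.
  apply: filterS (filterI ua (sC u)) => d [ad /negP ds].
  by exists [::]; split; rewrite /= andbT //; apply/asboolP.
(* As [star X] is everything, [X] meets the infinite set of predecessors of [b]. *)
have [u ub] := infinite_star binf.
have uX : star X u by rewrite XT.
have [c [[p [pe ps]] cb]] := filter_ex (filterI uX ub).
pose q := rcons (rcons p c) b.
have qe : path e a q by rewrite rcons_path pe last_rcons; apply/asboolP.
have qs : all (fun x => x \notin s) q by rewrite all_rcons sb.
have ql : last a q = b by rewrite last_rcons.
(* Cutting out loops makes the path duplicate-free without adding points. *)
case/shortenP: qe ql => r re /=/andP[_ rU] rq rl.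
by exists r; split=> //; apply/allP => x /rq/(allP qs).
Qed.

(** * Homeomorphisms induced by permutations of omega *)

Definition push_filter (f : nat -> nat) (u : omega_star) : beta_omega :=
  BetaOmega (@fmap_ultrafilter _ _ f _ (omega_star_ultra u)).

Lemma push_omega_star (f g : nat -> nat) (u : omega_star) : cancel f g ->
  push_filter f u \in omega_star.
Proof.
move=> fK; apply: in_omega_star => n /= un.
apply: (@omega_star_nonprincipal u (g n)).
by apply: filterS un => m /= <-; rewrite fK.
Qed.

Definition push (f g : nat -> nat) (fK : cancel f g) (u : omega_star) :
    omega_star :=
  SigSub (push_omega_star u fK).

Lemma push_continuous f g (fK : cancel f g) : continuous (push fK).
Proof.
move=> u V /omega_star_nbhsP[A uA AV].
have /omega_star_nbhs : star (f @^-1` A) u by exact: uA.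
by apply: (@filterS _ (nbhs u)) => v vA; exact: AV.
Qed.

Lemma pushK f g (fK : cancel f g) (gK : cancel g f) :
  cancel (push fK) (push gK).
Proof.
move=> u; apply: omega_star_eq => A /=.
rewrite /fmap /= -comp_preimage.
by rewrite (_ : g \o f = id) //; apply/funext => n /=; rewrite fK.
Qed.

Lemma homeomorphism_comp (X Y Z : topologicalType) (h : X -> Y) (k : Y -> Z) :
  homeomorphism h -> homeomorphism k -> homeomorphism (k \o h).
Proof.
move=> [hc [h' [hc' hK h'K]]] [kc [k' [kc' kK k'K]]].
split; first by move=> x; exact: (continuous_comp (hc x) (kc (h x))).
exists (h' \o k'); split; [|exact: can_comp|exact: can_comp].
by move=> x; exact: (continuous_comp (kc' x) (hc' (k' x))).
Qed.

Lemma push_homeo f g (fK : cancel f g) (gK : cancel g f) :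
  homeomorphism (push fK).
Proof.
split; first exact: push_continuous.
by exists (push gK); split; [exact: push_continuous|exact: pushK|exact: pushK].
Qed.

Lemma conjugate_homeo f g (fK : cancel f g) (gK : cancel g f) :
  homeomorphism (push fK \o shift_fun \o push gK).
Proof.
apply: homeomorphism_comp (push_homeo gK fK) _.
exact: homeomorphism_comp shift_fun_homeo (push_homeo fK gK).
Qed.

(** The conjugate acts as [f m] to [f m.+1]. The pulled-back ultrafilter contains all tails, so
    finitely many bad steps do not matter. *)
Lemma conjugate_obeys L f g (fK : cancel f g) (gK : cancel g f) M :
  (forall m, (M <= m)%N -> edge L (f m) (f m.+1)) ->
  obeys L (push fK \o shift_fun \o push gK).
Proof.
move=> fL p pL _ [u uA <-] /=.
have vA : star (f @^-1` p.1) (push gK u).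
  by rewrite /star /= /fmap /= -comp_preimage (_ : f \o g = id) //;
     apply/funext => n /=; rewrite gK.
have vM : star [set m | (M <= m)%N] (push gK u).
  apply: cofinite_mem_star; apply: sub_finite_set (finite_II M) => m /= /negP.
  by rewrite -ltnNge.
apply/shift_filterE; apply: filterS2 vA vM => m fm Mm.
exact: fL pL fm.
Qed.

(** * Constraint lists as a base of the compact-open topology *)

Lemma obeys_open L :
  open [set h : {compact-open, omega_star -> omega_star} | obeys L h].
Proof.
rewrite openE => h hL; apply: (filter_forall_in
  (P := fun p : set nat * set nat => [set k | k @` star p.1 `<=` star p.2])).
move=> p pL; apply: open_nbhs_nbhs; split; last exact: hL.
by apply: compact_open_open; [exact: star_compact|exact: star_open].
Qed.

(** The filter generated by the lists that [h] obeys converges to [h]: [compact_open_star] replaces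
    each subbasic constraint by a single pair. *)
Lemma obeys_nbhs (h : {compact-open, omega_star -> omega_star})
    (V : set {compact-open, omega_star -> omega_star}) :
  continuous (h : omega_star -> omega_star) -> nbhs h V ->
  exists2 L, obeys L h & forall k, obeys L k -> V k.
Proof.
move=> hc.
pose F : set_system {compact-open, omega_star -> omega_star} :=
  filter_from [set L | obeys L h] (fun L => [set k | obeys L k]).
have FF : Filter F.
  apply: filter_from_filter; first by exists [::].
  move=> L L' Lh L'h; exists (L ++ L').
    by move=> p; rewrite mem_cat => /orP[/Lh|/L'h].
  by move=> k kL; split=> p pL; apply: kL; rewrite mem_cat pL ?orbT.
have : F --> h.
  apply/compact_open_cvgP => K U Kc Uo hKU.
  have [A [B [KA AB BU]]] := compact_open_star hc Kc Uo hKU.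
  exists [:: (A, B)] => [p|k kL]; first by rewrite inE => /eqP ->.
  apply: subset_trans BU; apply: subset_trans (kL (A, B) (mem_head _ _)).
  exact: image_subset.
by move=> /[apply] -[L Lh LV]; exists L.
Qed.

Lemma iso_class_nbhs (f : homeo_group) (O : set (iso_class f))
    (h : iso_class f) :
  open O -> O h -> exists2 L, obeys L (\val (\val h)) &
    forall k : iso_class f, obeys L (\val (\val k)) -> O k.
Proof.
move=> [_ [W Wo <-] <-] /= Wh.
have hc : continuous (\val (\val h) : omega_star -> omega_star).
  by have [] := homeo_groupP (\val h).
have [|L Lh LW] := @obeys_nbhs (\val (\val h)) W hc.
  exact: open_nbhs_nbhs.
by exists L => // k /LW.
Qed.

Lemma iso_class_obeys_open (f : homeo_group) L :
  open [set h : iso_class f | obeys L (\val (\val h))].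
Proof.
exists [set h : homeo_group | obeys L (\val h)] => //.
by exists [set h : {compact-open, _ -> _} | obeys L h] => //; exact: obeys_open.
Qed.

(** * Common realization and the Baire property *)

Lemma obeys_realization (L : nat -> seq (set nat * set nat)) : L 0 = [::] ->
  (forall k, {subset L k <= L k.+1}) ->
  (forall k, exists h : iso_class shift, obeys (L k) (\val (\val h))) ->
  exists h : iso_class shift, forall k, obeys (L k) (\val (\val h)).
Proof.
move=> L0 Lmono Lh; pose e k a b := `[< edge (L k) a b >].
have [|||k a b s Fa Fb sa sb|f [g [fK gK fe]]] :=
  @enumeration_exists e (fun k => dead_ends (L k)).
- by move=> k a b /asboolP ab; apply/asboolP => p /Lmono; exact: ab.
(* With no constraints every pair is an edge, so a dead end would make omega finite. *)
- rewrite L0; apply/seteqP; split=> // a.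
  have ninf : ~ finite_set [set: nat] by exact: infinite_nat.
  by case=> /= fin; apply: ninf; apply: sub_finite_set fin.
- move=> k; have [h hL] := Lh k; apply: dead_ends_finite hL.
  exact: homeo_groupP.
- have [h hL] := Lh k; apply: edge_walk hL Fa Fb sa sb.
  exact: set_mem (valP h).
pose h : homeo_group := SigSub (mem_set (conjugate_homeo fK gK)).
have hs : iso_class shift h.
  exists (SigSub (mem_set (push_homeo gK fK))) => /=.
  by apply/funext => u /=; rewrite pushK.
exists (SigSub (mem_set hs)) => k /=; have [M fM] := fe k.
by apply: (@conjugate_obeys _ _ _ _ _ M) => m /fM/asboolP.
Qed.

Theorem lemma4p1 : baire_space (iso_class shift).
Proof.
move=> U UP O [h0 Oh0] Oo.
have [L0 L0h L0O] := iso_class_nbhs Oo Oh0.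
pose good L := exists h : iso_class shift, obeys L (\val (\val h)).
have step (nL : nat * seq (set nat * set nat)) : exists L', good nL.2 ->
    [/\ good L', {subset nL.2 <= L'} &
      forall h : iso_class shift, obeys L' (\val (\val h)) -> U nL.1 h].
  case: nL => n L /=; have [Lgood|nLgood] := pselect (good L); last first.
    by exists [::].
  have [Uo Ud] := UP n.
  (* Density of [U n] meets the nonempty open set of maps obeying [L]; appending a neighbourhood of
     that point inside [U n] gives the next list. *)
  have [h [hL Uh]] := Ud _ Lgood (iso_class_obeys_open shift L).
  have [L' L'h L'U] := iso_class_nbhs Uo Uh.
  exists (L ++ L') => _; split.
  - by exists h => p; rewrite mem_cat => /orP[/hL|/L'h].
  - by move=> p pL; rewrite mem_cat pL.
  - by move=> k kL; apply: L'U => p pL'; apply: kL; rewrite mem_cat pL' orbT.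
have [N NP] := choice step.
pose L := fix L n := if n is n'.+1 then N (n', L n') else L0.
have Lgood n : good (L n).
  by elim: n => [|n IHn]; [exists h0 | have [] := NP (n, L n) IHn].
(* An empty list is put in front because [obeys_realization] starts from one; this shifts indices,
   so [L n.+1], which forces membership in [U n], sits at [n.+2]. *)
have [k kL] : exists h : iso_class shift, forall n,
    obeys (if n is n'.+1 then L n' else [::]) (\val (\val h)).
  apply: obeys_realization => // -[|n] //; last exact: Lgood.
    by have [] := NP (n, L n) (Lgood n).
  by exists h0.
exists k; split; first exact: L0O (kL 1).
by move=> n _; have [_ _] := NP (n, L n) (Lgood n); apply; exact: (kL n.+2).
Qed.
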